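(* Let $\mathcal{X}$ be a monotone small class of graphs. Then $\mathcal{X}$ has bounded degeneracy, i.e., there exists a constant $d$ such that the degeneracy of every graph $G\in\mathcal{X}$ is at most $d$.
   Context: All graphs are finite, undirected, without loops or multiple edges. A class of graphs is a set of graphs closed under isomorphism. A class is monotone if it is closed under taking subgraphs (i.e., under vertex and edge deletions). For a class $\mathcal{X}$, $\mathcal{X}_n$ denotes the set of graphs in $\mathcal{X}$ with vertex set $[n]=\{1,\dots,n\}$. A class $\mathcal{X}$ is small if there is a constant $c$ such that $|\mathcal{X}_n|\leq n!\,c^n$ for every $n\in\mathbb{N}$. The degeneracy of a graph $G$ is the minimum $d$ such that every subgraph of $G$ has a vertex of degree at most $d$. *)

(* Defs.v *)
From HB Require Import structures.
From mathcomp Require Import all_boot all_order all_algebra.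
From mathcomp Require Import boolp reals.

Set Implicit Arguments.
Unset Strict Implicit.
Unset Printing Implicit Defensive.

(* The adjacency relation is stored as a finite function, so that equality of
   graphs is extensional and the graphs on [T] form a finite type. *)
Record sgraph (T : finType) := SGraph {
  adj : {ffun T -> {ffun T -> bool}};
  adj_axiom : [forall x, ~~ adj x x]
                && [forall x, forall y, adj x y == adj y x]
}.

HB.instance Definition _ (T : finType) := [isSub for @adj T].
HB.instance Definition _ (T : finType) := [Finite of sgraph T by <:].

Definition edge (T : finType) (G : sgraph T) : rel T := fun x y => adj G x y.

Definition degree (T : finType) (G : sgraph T) (x : T) : nat :=
  #|[set y | edge G x y]|.

Definition isomorphic (T U : finType) (G : sgraph T) (H : sgraph U) : Prop :=
  exists f : T -> U,
    bijective f /\ forall x y, edge H (f x) (f y) = edge G x y.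

(* A subgraph of [G] is a graph [H] whose vertex set is a subset [V] of that of
   [G] and each of whose edges is an edge of [G]. *)
Definition subgraph (T : finType) (G : sgraph T) (V : {set T})
    (H : sgraph {x : T | x \in V}) : bool :=
  [forall x, forall y, edge H x y ==> edge G (val x) (val y)].

(* The graph without vertices is excluded from the subgraphs considered here:
   it has no vertex at all, hence none of small degree. *)
Definition degenerate (T : finType) (G : sgraph T) (d : nat) : bool :=
  [forall V : {set T}, (V != set0) ==>
    [forall H : sgraph {x : T | x \in V}, subgraph G H ==>
      [exists v, degree H v <= d]]].

Lemma ex_degenerate (T : finType) (G : sgraph T) : exists d, degenerate G d.
Proof.
exists #|T|; apply/forallP => V; apply/implyP => /set0Pn[x xV].
apply/forallP => H; apply/implyP => _; apply/existsP; exists (Sub x xV).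
by rewrite (leq_trans (max_card _)) // card_sig max_card.
Qed.

Definition degeneracy (T : finType) (G : sgraph T) : nat :=
  ex_minn (ex_degenerate G).

Definition graph_family := forall T : finType, sgraph T -> Prop.

Definition is_graph_class (X : graph_family) : Prop :=
  forall (T U : finType) (G : sgraph T) (H : sgraph U),
    isomorphic G H -> X T G -> X U H.

Definition monotone_class (X : graph_family) : Prop :=
  forall (T : finType) (G : sgraph T) (V : {set T})
      (H : sgraph {x : T | x \in V}),
    subgraph G H -> X T G -> X {x : T | x \in V} H.

(* The vertex set [n] = {1, ..., n} is represented by 'I_n = {0, ..., n - 1}. *)
Definition labelled (X : graph_family) (n : nat) : {set sgraph 'I_n} :=
  [set G | `[< X 'I_n G >]].

Definition small_class (R : realType) (X : graph_family) : Prop :=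
  exists c : R, forall n : nat,
    (#|labelled X n|%:R <= n`!%:R * c ^+ n :> R)%R.

(* Main.v *)
Require Import Defs.
From mathcomp Require Import all_boot all_order all_algebra all_fingroup.
From mathcomp Require Import boolp reals.
From mathcomp Require Import zify.

(** Suppose that X contains graphs of arbitrarily large degeneracy.  Passing to
    a subgraph and then to the edges across a cut that keeps half of each degree
    ([exists_balanced_cut]) gives bipartite graphs in X with sides A and B, where
    |B| <= |A| and every vertex of A has d + 1 chosen neighbours in B, with d as
    large as desired.

    The point is to replace such a graph by one that is so well connected that
    the isomorphism type of a subgraph almost determines how it sits inside.
    Take an inclusion-minimal nonempty I in A whose neighbourhood has at most
    |I| elements ([tight_matched_core]).  By Hall's theorem I is perfectly
    matched to its neighbourhood, so that, with n = |I|, the bipartite graph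
    becomes a digraph R on n vertices, with a loop at each of them and with all
    outdegrees equal to d + 1; minimality of I says exactly that this digraph is
    strongly connected.  Degrees in B may be unbounded in terms of d, which is
    why all the choices below are made from the side of A, where each of them
    costs a factor d + 1 only.

    Let F consist of the matching and of the arcs of a spanning tree of R
    directed away from a root x0, and relabel the two sides of each q with
    F <= q <= R by permutations s and t.  The triple (s, t, q) can be recovered
    from the relabelled graph L and a little advice ([relabel_count]).  In L
    every left vertex has at most d + 1 neighbours, so d + 1 possibilities per
    left vertex describe the matching, and d + 1 possibilities per vertex
    describe, for a tree arc p -> j, which neighbour of s(p) is t(j).  Starting
    from s(x0), one then walks along the tree: s(p) gives t(j), and the matching
    gives s(j).  As F has at most 2n arcs, this yields

      n!^2 * 2 ^ ((d + 1) n - 2n) <= |X_2n| * n * (d + 1) ^ (2n).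

    Since (2n)! <= 4 ^ n * n!^2, this is incompatible with
    |X_2n| <= (2n)! c ^ (2n) as soon as 2 ^ (d + 1) exceeds a constant times
    c^2 (d + 1)^2, whatever the value of n ([count_contradiction]). *)

Set Implicit Arguments.
Unset Strict Implicit.
Unset Printing Implicit Defensive.

Import Order.TTheory GRing.Theory Num.Theory.

(** * Balanced cuts *)

Lemma edge_irr (T : finType) (G : sgraph T) x : edge G x x = false.
Proof.
by case/andP: (adj_axiom G) => /forallP irr _; apply/negbTE/irr.
Qed.

Lemma edge_sym (T : finType) (G : sgraph T) : symmetric (edge G).
Proof.
move=> x y; case/andP: (adj_axiom G) => _ /forallP/(_ x)/forallP/(_ y) sym.
exact/eqP.
Qed.

Definition cross_nbrs (T : finType) (G : sgraph T) (A : {set T}) x :=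
  [set y | edge G x y & (x \in A) != (y \in A)].

(** A maximum cut works: a vertex with more neighbours on its own side than on
    the other one could be moved across to enlarge the cut. *)
Lemma exists_balanced_cut (T : finType) (G : sgraph T) :
  exists A : {set T}, forall x, degree G x <= 2 * #|cross_nbrs G A x|.
Proof.
pose cut (A : {set T}) := \sum_x \sum_y (edge G x y && ((x \in A) != (y \in A)) : nat).
pose A := [arg max_(A > set0) cut A].
have maxA B : cut B <= cut A by rewrite /A; case: arg_maxnP => // C _; apply.
exists A => v.
pose B := [set x | (x == v) (+) (x \in A)].
have Bv x : (x \in B) = (x == v) (+) (x \in A) by rewrite inE.
pose inner := [set y | edge G v y & (v \in A) == (y \in A)].
have degE : degree G v = #|inner| + #|cross_nbrs G A v|.
  rewrite /degree -(cardsID [set y | (v \in A) == (y \in A)]).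
  by congr (_ + _); apply: eq_card => y; rewrite !inE // andbC.
(* isolates the pairs containing [v], the only ones that the switch affects *)
have split_cut C :
  cut C = 2 *
    \sum_(y | y != v) (edge G v y && ((v \in C) != (y \in C)) : nat)
    + \sum_(x | x != v) \sum_(y | y != v) (edge G x y && ((x \in C) != (y \in C)) : nat).
  rewrite /cut (bigD1 v) //= (bigD1 v) //= edge_irr add0n mul2n -addnn -addnA.
  congr (_ + _).
  rewrite -big_split /=; apply: eq_bigr => x xv.
  by rewrite (bigD1 v) //= edge_sym [(x \in C) == _]eq_sym.
have := maxA B; rewrite !split_cut.
have -> : \sum_(x | x != v) \sum_(y | y != v) (edge G x y && ((x \in B) != (y \in B)) : nat)
   = \sum_(x | x != v) \sum_(y | y != v) (edge G x y && ((x \in A) != (y \in A)) : nat).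
  apply: eq_bigr => x /negbTE xv; apply: eq_bigr => y /negbTE yv.
  by rewrite !Bv xv yv.
rewrite leq_add2r leq_pmul2l //.
have cardE (P : pred T) :
    \sum_(y | y != v) (edge G v y && P y : nat) = #|[set y | edge G v y & P y]|.
  rewrite -sum1dep_card big_mkcond [RHS]big_mkcond; apply: eq_bigr => y _ /=.
  by case: eqVneq => [->|_]; rewrite ?edge_irr //; case: (_ && _).
rewrite !(cardE (fun y => (v \in _) != (y \in _))) => le_cross.
rewrite degE mul2n -addnn leq_add2r; apply: leq_trans le_cross.
apply: subset_leq_card; apply/subsetP => y; rewrite !inE eqxx => /andP[vy].
have /negbTE -> : y != v by apply: contraTneq vy => ->; rewrite edge_irr.
by rewrite vy; case: (v \in A) (y \in A) => [] [].
Qed.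

(** * Hall's theorem *)

Definition nbhd (T S : finType) (N : T -> {set S}) (A : {set T}) := \bigcup_(x in A) N x.

Lemma nbhdU (T S : finType) (N : T -> {set S}) (A B : {set T}) :
  nbhd N (A :|: B) = nbhd N A :|: nbhd N B.
Proof. exact: bigcup_setU. Qed.

Lemma nbhdD (T S : finType) (N : T -> {set S}) (Y : {set S}) (A : {set T}) :
  nbhd (fun x => N x :\: Y) A = nbhd N A :\: Y.
Proof.
apply/setP => y; rewrite inE; apply/bigcupP/andP.
  by case=> x xA; rewrite inE => /andP[-> yx]; split=> //; apply/bigcupP; exists x.
by case=> yY /bigcupP[x xA yx]; exists x => //; rewrite inE yY.
Qed.

Lemma nbhdS (T S : finType) (N : T -> {set S}) (A B : {set T}) :
  A \subset B -> nbhd N A \subset nbhd N B.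
Proof. by move=> /setUidPr <-; rewrite nbhdU subsetUl. Qed.

(** The induction of Halmos and Vaughan: if some nonempty proper subset is tight,
    match it and the rest separately; otherwise every such subset has a spare
    neighbour, and an arbitrary edge can be put in the matching.  The point [s0]
    supplies the values of [f] outside [A]. *)
Lemma hall_marriage (T S : finType) (s0 : S) (N : T -> {set S}) (A : {set T}) :
  (forall U : {set T}, U \subset A -> #|U| <= #|nbhd N U|) ->
  exists f : T -> S, {in A, forall x, f x \in N x} /\ {in A &, injective f}.
Proof.
elim: {A}#|A|.+1 {-2}A (ltnSn #|A|) N => // m IH A lt_Am N hallA.
have [->|[x xA]] := set_0Vmem A.
  by exists (fun=> s0); split=> [x|x y]; rewrite inE.
have [/existsP[U /and3P[UA U0 tightU]]|/existsPn noTight] :=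
  boolP [exists U : {set T}, [&& U \proper A, U != set0 & #|nbhd N U| <= #|U|]].
  have [f [fN f_inj]] : exists f : T -> S,
      {in U, forall x, f x \in N x} /\ {in U &, injective f}.
    apply: IH => [|W WU]; first by have := proper_card UA; lia.
    by apply: hallA; apply: subset_trans WU (proper_sub UA).
  have [g [gN g_inj]] : exists g : T -> S,
      {in A :\: U, forall x, g x \in N x :\: nbhd N U} /\ {in A :\: U &, injective g}.
    apply: (IH _ _ (fun x => N x :\: nbhd N U)) => [|W].
      have := cardsID U A; rewrite (setIidPr (proper_sub UA)).
      by move: U0; rewrite -card_gt0; lia.
    rewrite subsetD => /andP[WA disWU]; rewrite nbhdD.
    have := hallA (W :|: U); rewrite subUset WA proper_sub // => /(_ isT).
    rewrite nbhdU cardsU (disjoint_setI0 disWU) cards0.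
    rewrite -[_ :|: nbhd N U]setUC -(cardsID (nbhd N U) (nbhd N U :|: _)).
    rewrite setUK setDUl setDv set0U; lia.
  exists (fun z => if z \in U then f z else g z); split=> [z zA|z w zA wA].
    case: ifP => zU; first exact: fN.
    by have := gN z; rewrite !inE zU zA => /(_ isT)/andP[].
  have gU u : u \in A -> u \notin U -> g u \notin nbhd N U.
    by move=> uA uU; have := gN u; rewrite !inE uU uA => /(_ isT)/andP[].
  have fU u : u \in U -> f u \in nbhd N U.
    by move=> uU; apply/bigcupP; exists u; rewrite ?fN.
  case: ifPn => zU; case: ifPn => wU; first exact: f_inj.
  - by move=> fg; move: (gU w wA wU); rewrite -fg fU.
  - by move=> fg; move: (gU z zA zU); rewrite fg fU.
  by apply: g_inj; rewrite inE ?zU ?wU.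
have [y yx] : exists y, y \in N x.
  apply/set0Pn; rewrite -card_gt0; have := hallA [set x].
  by rewrite sub1set cards1 /nbhd big_set1; apply.
have [f [fN f_inj]] : exists f : T -> S, {in A :\ x, forall z, f z \in N z :\ y}
    /\ {in A :\ x &, injective f}.
  apply: (IH _ _ (fun z => N z :\ y)) => [|W WA].
    by move: lt_Am; rewrite (cardsD1 x A) xA; lia.
  rewrite nbhdD; have [->|W0] := eqVneq W set0; first by rewrite cards0.
  have := noTight W; rewrite W0 (sub_proper_trans WA (properD1 xA)) /= -ltnNge.
  by rewrite (cardsD1 y (nbhd N W)); case: (y \in _); lia.
exists (fun z => if z == x then y else f z); split=> [z zA|z w zA wA].
  case: eqVneq => [->|zx] //; have := fN z; rewrite !inE zx zA => /(_ isT).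
  by case/andP.
have fy u : u \in A -> u != x -> f u != y.
  by move=> uA ux; have := fN u; rewrite !inE ux uA => /(_ isT)/andP[].
case: eqVneq => [->|zx]; case: eqVneq => [->|wx] //.
- by move=> yf; have := fy w wA wx; rewrite -yf eqxx.
- by move=> fy'; have := fy z zA zx; rewrite fy' eqxx.
by apply: f_inj; rewrite !inE ?zx ?wx.
Qed.

(** * A strongly connected core *)

(** For an inclusion-minimal nonempty [I] with [#|nbhd N I| <= #|I|], all proper
    nonempty subsets have more neighbours than elements.  This gives Hall's
    condition for [I], hence an enumeration [a] of [I] and one [b] of its
    neighbourhood such that [b i \in N (a i)].  The indices reachable from [i]
    form a set [U] with [nbhd N (a @: U) \subset b @: U], so by minimality they
    are all the indices. *)
Lemma tight_matched_core (T S : finType) (N : T -> {set S}) (A : {set T}) :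
  A != set0 -> #|nbhd N A| <= #|A| -> {in A, forall x, N x != set0} ->
  exists (n : nat) (a : 'I_n.+1 -> T) (b : 'I_n.+1 -> S),
    [/\ injective a, injective b, (forall i, a i \in A),
        (forall i, b i \in N (a i) /\ N (a i) \subset codom b)
      & forall i j, connect (fun i j => b j \in N (a i)) i j].
Proof.
move=> A0 tightA N0.
pose P (I : {set T}) := (I != set0) && (#|nbhd N I| <= #|I|).
have [I minI IA] : {I | minset P I & I \subset A} by apply: minset_exists; rewrite /P A0.
have /andP[I0 tightI] := minsetp minI.
have strict (U : {set T}) : U \proper I -> U != set0 -> #|U| < #|nbhd N U|.
  move=> UI U0; rewrite ltnNge; apply/negP => tU; have := UI.
  by rewrite (minsetinf minI _ (proper_sub UI)) ?properxx // /P U0.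
have [x xI] := set0Pn _ I0.
have hallI (U : {set T}) : U \subset I -> #|U| <= #|nbhd N U|.
  have [->|U0] := eqVneq U set0; first by rewrite cards0.
  rewrite subEproper => /orP[/eqP ->|UI]; last exact: ltnW (strict U UI U0).
  rewrite (cardsD1 x I) xI add1n.
  have [E|I'0] := eqVneq (I :\ x) set0.
    rewrite E cards0 card_gt0; have /set0Pn[y yx] := N0 x (subsetP IA x xI).
    by apply/set0Pn; exists y; apply/bigcupP; exists x.
  apply: leq_trans (strict _ (properD1 xI) I'0) (subset_leq_card _).
  exact/nbhdS/subsetDl.
have /set0Pn[s0 _] := N0 x (subsetP IA x xI).
have [f [fN f_inj]] := hall_marriage s0 hallI.
have fI : f @: I = nbhd N I.
  apply/eqP; rewrite eqEcard (card_in_imset f_inj) tightI andbT.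
  by apply/subsetP => _ /imsetP[z zI ->]; apply/bigcupP; exists z; rewrite ?fN.
have cardI : #|I| = #|I|.-1.+1 by rewrite prednK // card_gt0.
pose a (i : 'I_(#|I|.-1.+1)) := enum_val (cast_ord (esym cardI) i).
have a_inj : injective a by move=> i j /enum_val_inj/cast_ord_inj.
have aI i : a i \in I by exact: enum_valP.
have aV z : z \in I -> exists i, a i = z.
  move=> zI; exists (cast_ord cardI (enum_rank_in zI z)).
  by rewrite /a cast_ordK enum_rankK_in.
have b_inj : injective (f \o a) by move=> i j /= /f_inj E; apply: a_inj; apply: E.
have cod i s : s \in N (a i) -> exists j, s = f (a j).
  move=> sN; have : s \in f @: I by rewrite fI; apply/bigcupP; exists (a i).
  by case/imsetP=> z /aV[j <-] ->; exists j.
exists #|I|.-1, a, (f \o a); split=> // [i|i|i j].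
- exact: subsetP (aI i).
- split=> /=; first exact: fN.
  by apply/subsetP => s /cod[j ->]; apply/codomP; exists j.
set r := (fun _ _ => _) : rel _.
pose U := [set k | connect r i k].
have iU : i \in U by rewrite inE connect0.
suff /setP/(_ (a j)) : a @: U = I.
  by rewrite aI mem_imset // inE.
have aUI : a @: U \subset I by apply/subsetP => _ /imsetP[k _ ->].
apply: (minsetinf minI) => //; rewrite /P; apply/andP; split.
  by apply/set0Pn; exists (a i); rewrite mem_imset.
rewrite (card_imset _ a_inj) -(card_imset _ b_inj).
apply/subset_leq_card/subsetP => s /bigcupP[_ /imsetP[k kU ->] sk].
have [l sl] := cod k s sk; apply/imsetP; exists l => //.
move: kU; rewrite !inE => /connect_trans; apply; apply: connect1.
by rewrite /r -[_ \o _]/(f \o a) /= -sl.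
Qed.

(** A spanning tree directed away from [x0]: the parent of [x] is its predecessor
    on a shortest walk from [x0], and [h] is the distance from [x0]. *)
Lemma connect_parent (T : finType) (r : rel T) (x0 : T) :
  (forall x, connect r x0 x) ->
  exists (par : T -> T) (h : T -> nat),
    forall x, x != x0 -> r (par x) x /\ h (par x) < h x.
Proof.
move=> conn.
pose walk x n := [exists p : n.-tuple T, path r x0 p && (x == last x0 p)].
have ex_walk x : exists n, walk x n.
  have /connectP[p rp ->] := conn x.
  by exists (size p); apply/existsP; exists (in_tuple p); rewrite rp /=.
pose h x := ex_minn (ex_walk x).
have hP x n : walk x n -> h x <= n by rewrite /h; case: ex_minnP => m _; apply.
suff /fin_all_exists[par parP] : forall x, exists y, x != x0 -> r y x /\ h y < h x.
  by exists par, h.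
move=> x; case: (eqVneq x x0) => [_|xx0]; first by exists x0.
have /existsP[[p /= /eqP sp] /andP[rp /eqP xp]] : walk x (h x).
  by rewrite /h; case: ex_minnP.
case/lastP: p => [|p y] in sp rp xp *; first by rewrite xp eqxx in xx0.
rewrite last_rcons in xp; rewrite -xp rcons_path size_rcons in rp sp.
case/andP: rp => rp rx; exists (last x0 p) => _; split=> //.
rewrite -sp ltnS; apply: hP; apply/existsP; exists (in_tuple p).
by rewrite /= rp eqxx.
Qed.

(** * Counting relabelled bipartite graphs *)

Definition relabel (n : nat) (s t : 'S_n) (q : {set 'I_n * 'I_n}) :=
  [set (s p.1, t p.2) | p in q].

Lemma mem_relabel (n : nat) (s t : 'S_n) q i j :
  ((s i, t j) \in relabel s t q) = ((i, j) \in q).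
Proof.
have inj_st : injective (fun p : 'I_n * 'I_n => (s p.1, t p.2)).
  by move=> [x y] [x' y'] [/perm_inj <- /perm_inj <-].
exact: (mem_imset _ (i, j) inj_st).
Qed.

Definition row_set (n : nat) (L : {set 'I_n * 'I_n}) (x : 'I_n) :=
  [set y | (x, y) \in L].

Lemma card_row_relabel (n : nat) (s t : 'S_n) (q : {set 'I_n * 'I_n}) x :
  #|row_set (relabel s t q) (s x)| = #|row_set q x|.
Proof.
rewrite -(card_imset (mem (row_set q x)) (@perm_inj _ t)); apply: eq_card => y.
by rewrite -[y](permKV t) inE mem_relabel mem_imset ?inE //; apply: perm_inj.
Qed.

(** The rank of [y] among the neighbours of [x]; it is meaningful only when [x]
    has at most [d.+1] neighbours and [y] is one of them. *)
Definition row_index (n d : nat) (L : {set 'I_n * 'I_n}) (x y : 'I_n) : 'I_d.+1 :=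
  inord (index y (enum (row_set L x))).

Lemma row_index_inj (n d : nat) (L : {set 'I_n * 'I_n}) x y y' :
  #|row_set L x| <= d.+1 -> (x, y) \in L -> (x, y') \in L ->
  row_index d L x y = row_index d L x y' -> y = y'.
Proof.
move=> row_d Ly Ly' /(congr1 val).
have idx z : (x, z) \in L -> index z (enum (row_set L x)) < d.+1.
  move=> Lz; apply: leq_trans row_d.
  by rewrite cardE index_mem mem_enum inE.
rewrite /= !inordK ?idx // => eq_idx.
by rewrite -(nth_index y (s := enum (row_set L x)) (x := y)) ?mem_enum ?inE //
  eq_idx nth_index // mem_enum inE.
Qed.

(** The encoding argument.  The triples [(s, t, q)] with [q \subset R :\: F] are
    mapped injectively to the relabelling [L] of [F :|: q] together with the image
    of the root, the rank in [L] of the match of each left vertex, and the rank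
    in [L] of each right vertex [t j] among the neighbours of [s (par j)].  All
    these ranks are below [d.+1] because rows of [L] are relabelled rows of
    subsets of [R]. *)
Lemma relabel_count (n d : nat) (R F : {set 'I_n * 'I_n}) (x0 : 'I_n)
    (par : 'I_n -> 'I_n) (h : 'I_n -> nat) (Q : {set {set 'I_n * 'I_n}}) :
  F \subset R -> (forall i, #|row_set R i| <= d.+1) -> (forall i, (i, i) \in F) ->
  (forall j, j != x0 -> (par j, j) \in F /\ h (par j) < h j) ->
  (forall s t (q : {set _}), q \subset R -> relabel s t q \in Q) ->
  n`! * n`! * 2 ^ #|R :\: F| <= #|Q| * (n * d.+1 ^ n * d.+1 ^ n).
Proof.
move=> FR rowR diagF parF QR.
pose code (u : 'S_n * 'S_n * {set 'I_n * 'I_n}) :=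
  let: (s, t, q) := u in let L := relabel s t (F :|: q) in
  (L, (s x0, [ffun x => row_index d L x (t ((s^-1)%g x))],
    [ffun j => row_index d L (s (par j)) (t j)])).
pose D := setX [set: 'S_n * 'S_n] (powerset (R :\: F)).
have -> : n`! * n`! * 2 ^ #|R :\: F| = #|D|.
  by rewrite cardsX cardsT card_prod card_Sn card_powerset.
have -> : #|Q| * (n * d.+1 ^ n * d.+1 ^ n)
   = #|setX Q [set: 'I_n * {ffun 'I_n -> 'I_d.+1} * {ffun 'I_n -> 'I_d.+1}]|.
  by rewrite cardsX cardsT !card_prod !card_ffun !card_ord.
have subR (q : {set _}) : q \subset R :\: F -> F :|: q \subset R.
  by move=> qRF; rewrite subUset FR (subset_trans qRF (subsetDl R F)).
rewrite -(@card_in_imset _ _ code (mem D)).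
  apply/subset_leq_card/subsetP => _ /imsetP[[[s t] q] + ->].
  by rewrite !inE /= andbT => /subR; apply: QR.
move=> [[s t] q] [[s' t'] q']; rewrite !inE /= => qRF q'RF.
case=> eqL eq_root /ffunP eq_match /ffunP eq_child.
set L := relabel s t _ in eqL eq_match eq_child.
have rowL x : #|row_set L x| <= d.+1.
  rewrite -[x](permKV s) card_row_relabel; apply: leq_trans (rowR (s^-1%g x)).
  apply/subset_leq_card/subsetP => y; rewrite !inE => yq.
  by have /subsetP := subR _ qRF; apply; rewrite inE.
have FL i j : (i, j) \in F -> (s i, t j) \in L by move=> ij; rewrite mem_relabel inE ij.
have FL' i j : (i, j) \in F -> (s' i, t' j) \in L.
  by move=> ij; rewrite eqL mem_relabel inE ij.
(* the first family of ranks determines the matching [t \o s^-1] of [L] *)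
have matchE x : t (s^-1%g x) = t' (s'^-1%g x).
  apply: (row_index_inj (rowL x)).
  - by have := FL _ _ (diagF (s^-1%g x)); rewrite permKV.
  - by have := FL' _ _ (diagF (s'^-1%g x)); rewrite permKV.
  by have := eq_match x; rewrite !ffunE -eqL.
(* walking down the tree: the second family of ranks gives [t j] once
   [s (par j)] is known, and the matching then gives [s j] *)
have eq_s : s = s'.
  apply/permP => j; have [m] := ubnP (h j); elim: m j => // m IH j hj.
  have [->//|/parF[pF hp]] := eqVneq j x0.
  have IHp : s (par j) = s' (par j) by apply: IH; apply: leq_trans hp hj.
  have eq_tj : t j = t' j.
    apply: (row_index_inj (rowL (s (par j)))); rewrite ?FL //.
      by rewrite IHp FL'.
    by have := eq_child j; rewrite !ffunE -eqL IHp.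
  have := matchE (s' j); rewrite permK -eq_tj => /perm_inj E.
  by rewrite -[s' j](permKV s) E.
have eq_t : t = t' by apply/permP => j; have := matchE (s j); rewrite -eq_s !permK.
rewrite -eq_s -eq_t in eqL *; congr (_, _).
have eqF : F :|: q = F :|: q'.
  by apply/setP => -[i j]; rewrite -(mem_relabel s t) -/L eqL mem_relabel.
have qE (p : {set _}) : p \subset R :\: F -> p = (F :|: p) :\: F.
  by rewrite subsetD => /andP[_ dis]; rewrite setDUl setDv set0U; apply/esym/setDidPl.
by rewrite (qE q) // eqF -qE.
Qed.

(** * Bipartite graphs in a monotone class *)

Lemma class_embedding (X : graph_family) (T U : finType) (G : sgraph T)
    (H : sgraph U) (f : U -> T) :
  is_graph_class X -> monotone_class X -> X T G -> injective f ->
  (forall x y, edge H x y -> edge G (f x) (f y)) -> X U H.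
Proof.
move=> X_class X_mono XG f_inj fH.
pose V := [set f x | x in U].
have inV x : f x \in V by apply: imset_f.
pose g (x : U) : {y : T | y \in V} := exist _ (f x) (inV x).
have g_inj : injective g by move=> x y /(congr1 val) /f_inj.
have g_bij : bijective g.
  apply: inj_card_bij => //; rewrite card_sig -(card_imset predT f_inj).
  by apply/subset_leq_card/subsetP.
have [g' gK g'K] := g_bij.
pose a := [ffun x => [ffun y => edge H (g' x) (g' y)]].
have a_ax : [forall x, ~~ a x x] && [forall x, forall y, a x y == a y x].
  apply/andP; split; apply/forallP => x; first by rewrite !ffunE edge_irr.
  by apply/forallP => y; rewrite !ffunE edge_sym.
pose H' := SGraph a_ax.
have H'E x y : edge H' x y = edge H (g' x) (g' y) by rewrite /edge /= !ffunE.
apply: (X_class _ _ H' H).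
  by exists g'; split=> [|x y]; [exists g | rewrite H'E].
apply: X_mono XG; apply/forallP => x; apply/forallP => y; apply/implyP.
by rewrite H'E -{2}[x]g'K -{2}[y]g'K; apply: fH.
Qed.

Definition biadj (n : nat) (L : {set 'I_n * 'I_n}) (u v : 'I_n + 'I_n) :=
  match u, v with
  | inl i, inr j => (i, j) \in L
  | inr j, inl i => (i, j) \in L
  | _, _ => false
  end.

Definition bigraph_adj (n : nat) (L : {set 'I_n * 'I_n}) :=
  [ffun u : 'I_(n + n) => [ffun v : 'I_(n + n) => biadj L (split u) (split v)]].

Lemma bigraph_axiom (n : nat) (L : {set 'I_n * 'I_n}) :
  [forall u, ~~ bigraph_adj L u u]
    && [forall u, forall v, bigraph_adj L u v == bigraph_adj L v u].
Proof.
apply/andP; split; apply/forallP => u; first by rewrite !ffunE; case: (split u).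
by apply/forallP => v; rewrite !ffunE; case: (split u); case: (split v).
Qed.

Definition bigraph (n : nat) (L : {set 'I_n * 'I_n}) : sgraph 'I_(n + n) :=
  SGraph (bigraph_axiom L).

Lemma bigraphE (n : nat) (L : {set 'I_n * 'I_n}) u v :
  edge (bigraph L) u v = biadj L (split u) (split v).
Proof. by rewrite /edge /= !ffunE. Qed.

Lemma bigraph_inj (n : nat) : injective (@bigraph n).
Proof.
move=> L L' eqLL'; apply/setP => -[i j].
have := bigraphE L (unsplit (inl i)) (unsplit (inr j)).
by rewrite eqLL' bigraphE !unsplitK.
Qed.

(** The bound of [relabel_count] when [F] consists of the matching and of the
    spanning tree, so that [#|F| <= n + n] and [#|R| = d.+1 * n].  Every relabelled
    graph embeds in [G] via [a \o s^-1] and [b \o t^-1], hence it lies in [X]. *)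
Lemma core_count (X : graph_family) (T : finType) (G : sgraph T) (n d : nat)
    (a b : 'I_n -> T) (x0 : 'I_n) (R : {set 'I_n * 'I_n}) :
  is_graph_class X -> monotone_class X -> X T G ->
  injective a -> injective b -> (forall i j, a i != b j) ->
  (forall i j, (i, j) \in R -> edge G (a i) (b j)) ->
  (forall i, #|row_set R i| = d.+1) -> (forall i, (i, i) \in R) ->
  (forall i, connect (fun i j => (i, j) \in R) x0 i) ->
  n`! * n`! * 2 ^ (d.+1 * n - (n + n))
    <= #|labelled X (n + n)| * (n * d.+1 ^ n * d.+1 ^ n).
Proof.
move=> X_class X_mono XG a_inj b_inj ab Redge rowR diagR.
case/connect_parent=> par [h parP].
pose F := [set (i, i) | i in 'I_n] :|: [set (par j, j) | j in [set~ x0]].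
have cardF : #|F| <= n + n.
  apply: leq_trans (leq_card_setU _ _) _.
  by apply: leq_add; apply: leq_trans (leq_imset_card _ _) _;
    rewrite -[X in _ <= X]card_ord max_card.
have cardR : #|R| = d.+1 * n.
  have -> : #|R| = \sum_i #|row_set R i|.
    rewrite -sum1_card (eq_bigl (fun p : 'I_n * 'I_n => (p.1, p.2) \in R)); last by case.
    rewrite -(pair_big_dep xpredT (fun i j => (i, j) \in R) (fun _ _ => 1)) /=.
    by apply: eq_bigr => i _; rewrite sum1dep_card.
  by under eq_bigr => i _ do rewrite rowR; rewrite sum_nat_const card_ord mulnC.
pose Q := [set L | bigraph L \in labelled X (n + n)].
have QE : #|Q| <= #|labelled X (n + n)|.
  rewrite -(card_imset _ (@bigraph_inj n)).
  by apply/subset_leq_card/subsetP => _ /imsetP[L + ->]; rewrite inE.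
have FR : F \subset R.
  rewrite subUset; apply/andP; split; apply/subsetP => _ /imsetP[j jx ->] //.
  by rewrite !inE in jx; have [] := parP j jx.
apply: leq_trans (leq_mul QE (leqnn _)).
apply: leq_trans (_ : n`! * n`! * 2 ^ #|R :\: F| <= _).
  rewrite leq_mul2l leq_pexp2l ?orbT //.
  by rewrite cardsD (setIidPr FR) cardR; apply: leq_sub2l.
apply: (relabel_count (x0 := x0) (par := par) (h := h)) => // [i|i|j jx|s t q qR].
- by rewrite rowR.
- by rewrite inE imset_f.
- by have [_ hj] := parP j jx; rewrite inE imset_f ?orbT // !inE.
rewrite inE inE; apply/asboolP.
pose f (w : 'I_(n + n)) := match split w with
  | inl x => a (s^-1%g x) | inr y => b (t^-1%g y) end.
apply: (class_embedding (G := G) (f := f)) => // [w w'|w w'].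
  rewrite /f => E; apply: (can_inj (@splitK n n)); move: E.
  case: (split w) (split w') => [x|y] [x'|y'].
  - by move=> /a_inj/perm_inj ->.
  - by move=> E; have := ab (s^-1%g x) (t^-1%g y'); rewrite E eqxx.
  - by move=> E; have := ab (s^-1%g x') (t^-1%g y); rewrite E eqxx.
  - by move=> /b_inj/perm_inj ->.
have edgeL x y : (x, y) \in relabel s t q -> edge G (a (s^-1%g x)) (b (t^-1%g y)).
  rewrite -{1}[x](permKV s) -{1}[y](permKV t) mem_relabel => /(subsetP qR).
  exact: Redge.
rewrite bigraphE /f; case: (split w) (split w') => [x|y] [x'|y'] //=.
  exact: edgeL.
by move=> /edgeL; rewrite edge_sym.
Qed.

(** A balanced cut leaves every vertex more than [d] neighbours across; taking for
    [A] the larger side makes its neighbourhood no larger than [A], as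
    [tight_matched_core] requires.  Keeping exactly [d.+1] neighbours of each vertex
    makes all rows equally long, so that the advice and the number of subgraphs
    are both governed by [d] alone. *)
Lemma min_degree_count (X : graph_family) (T : finType) (G : sgraph T) (d : nat) :
  is_graph_class X -> monotone_class X -> X T G ->
  0 < #|T| -> (forall x, 2 * d < degree G x) ->
  exists n : nat, 0 < n /\
    n`! * n`! * 2 ^ (d.+1 * n - (n + n))
    <= #|labelled X (n + n)| * (n * d.+1 ^ n * d.+1 ^ n).
Proof.
move=> X_class X_mono XG /card_gt0P[x1 _] degG.
have [C0 C0P] := exists_balanced_cut G.
have [A [A0 tightA crossA]] : exists A : {set T}, [/\ A != set0, #|~: A| <= #|A|
    & forall x, d < #|cross_nbrs G A x|].
  have cross0 x : d < #|cross_nbrs G C0 x| by have := C0P x; have := degG x; lia.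
  have crossC x : cross_nbrs G (~: C0) x = cross_nbrs G C0 x.
    by apply/setP => y; rewrite !inE; case: (x \in C0) (y \in C0) => [] [].
  have cT : 0 < #|C0| + #|~: C0| by rewrite cardsC; apply/card_gt0P; exists x1.
  have [le|lt] := leqP #|~: C0| #|C0|; [exists C0 | exists (~: C0)].
    by split=> //; rewrite -card_gt0; lia.
  by split=> [||x]; rewrite ?crossC // ?setCK -?card_gt0; lia.
have ex_N x : exists N : {set T}, N \subset cross_nbrs G A x /\ #|N| = d.+1.
  have leN := crossA x.
  exists [set y in take d.+1 (enum (cross_nbrs G A x))]; split.
    by apply/subsetP => y; rewrite inE => /mem_take; rewrite mem_enum.
  rewrite cardsE (card_uniqP (take_uniq _ (enum_uniq _))) size_takel //.
  by rewrite -cardE.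
have [N NP] := fin_all_exists ex_N.
have N_cross x y : y \in N x -> edge G x y /\ (x \in A) != (y \in A).
  by have [/subsetP sub _] := NP x; move/sub; rewrite !inE => /andP[].
have [||n [a [b [a_inj b_inj aA abN conn]]]] := @tight_matched_core _ _ N A A0.
- apply: leq_trans tightA; apply/subset_leq_card/subsetP => y /bigcupP[x xA /N_cross[_]].
  by rewrite xA inE; case: (y \in A).
- by move=> x xA; rewrite -card_gt0; have [_ ->] := NP x.
exists n.+1; split=> //.
pose R := [set p : 'I_n.+1 * 'I_n.+1 | b p.2 \in N (a p.1)].
have bA j : b j \notin A.
  by have [/N_cross[_ ]] := abN j; rewrite aA; case: (b j \in A).
apply: (core_count (a := a) (b := b) (x0 := ord0) (R := R) X_class X_mono XG) => //.
- by move=> i j; apply: contraTneq (aA i) => ->; apply: bA.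
- by move=> i j; rewrite inE => /N_cross[].
- move=> i; have [_ <-] := NP (a i); rewrite -(card_imset _ b_inj).
  apply: eq_card => y; apply/imsetP/idP => [[j + ->]|yN]; first by rewrite !inE.
  have [_ /subsetP/(_ y yN)/codomP[j yj]] := abN i; exists j => //.
  by rewrite !inE -yj.
- by move=> i; rewrite inE; case: (abN i).
- by move=> i; rewrite (eq_connect (e' := fun i j => b j \in N (a i))) // => x y;
    rewrite inE.
Qed.

(** * Numerical estimates *)

(** The central binomial coefficient is one of the terms of [(1 + 1) ^ (n + n)]. *)
Lemma fact_double_le (n : nat) : (n + n)`! <= 4 ^ n * (n`! * n`!).
Proof.
rewrite -(@bin_fact (n + n) n) ?leq_addr // addnK leq_mul2r; apply/orP; right.
have -> : 4 ^ n = (1 + 1) ^ (n + n) by rewrite -[1 + 1]/2 addnn -mul2n expnM.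
by rewrite expnDn (bigD1 (inord n)) //= inordK ?ltnS ?leq_addr // !exp1n !muln1 leq_addr.
Qed.

Lemma small_class_nat (R : realType) (X : graph_family) :
  small_class R X -> exists c : nat, forall n, #|labelled X n| <= n`! * c.+1 ^ n.
Proof.
case=> c cP; exists (Num.truncn `|c|%R) => n.
rewrite -(ler_nat R) natrM natrX; apply: le_trans (cP n) _.
apply: ler_wpM2l; first exact: ler0n.
apply: le_trans (ler_norm _) _; rewrite normrX.
apply: lerXn2r; rewrite ?nnegrE ?ler0n //.
exact/ltW/truncnS_gt.
Qed.

Lemma exp_beats_quadratic (K : nat) : exists d, K * d.+1 ^ 2 < 2 ^ d.+1 .
Proof.
(* [m] is chosen so that [K * (4 * m) ^ 2 <= m * (m * m)] and [m < 2 ^ m] *)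
pose m := 16 * K.+1; exists (4 * m).-1; rewrite prednK ?muln_gt0 //.
have m2 : m < 2 ^ m by apply: ltn_expl.
have -> : 2 ^ (4 * m) = 2 ^ m * 2 ^ m * (2 ^ m * 2 ^ m).
  by rewrite -!expnD; congr (_ ^ _); lia.
have -> : K * (4 * m) ^ 2 = 16 * K * (m * m) by rewrite -mulnn; lia.
apply: leq_ltn_trans (leq_mul (leqnn _) (leq_mul (ltnW m2) (ltnW m2))) _.
rewrite ltn_pmul2r ?muln_gt0 ?expn_gt0 //.
by apply: leq_trans (leq_mul m2 (_ : 1 <= 2 ^ m)); rewrite ?expn_gt0 //; lia.
Qed.

(** After dividing by [n`! * n`!] and multiplying by [4 ^ n], all remaining factors
    are [n]-th powers except [n] itself, which is below [2 ^ n]; the constant 32 is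
    4 from [fact_double_le], 4 from the edges of [F] and 2 from this last
    factor. *)
Lemma count_contradiction (c d n L : nat) :
  0 < n -> 32 * c.+1 ^ 2 * d.+1 ^ 2 < 2 ^ d.+1 -> 
  L <= (n + n)`! * c.+1 ^ (n + n) ->
  n`! * n`! * 2 ^ (d.+1 * n - (n + n)) <= L * (n * d.+1 ^ n * d.+1 ^ n) -> False.
Proof.
move=> n0 hd hL.
apply/negP; rewrite -ltnNge.
apply: leq_ltn_trans (leq_mul hL (leqnn _)) _.
apply: leq_ltn_trans (leq_mul (leq_mul (fact_double_le n) (leqnn _)) (leqnn _)) _.
have f0 : 0 < n`! * n`! by rewrite muln_gt0 fact_gt0.
rewrite -(ltn_pmul2r (m := 4 ^ n)) ?expn_gt0 //.
have -> : n`! * n`! * 2 ^ (d.+1 * n - (n + n)) * 4 ^ n = n`! * n`! * (2 ^ d.+1) ^ n.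
  rewrite -mulnA -[4]/(2 ^ 2) -!expnM -expnD; congr (_ * 2 ^ _).
  rewrite mul2n -addnn subnK //.
  suff : 1 < d.+1 by nia.
  by case: (d) hd => //; rewrite -mulnn; nia.
have -> : 4 ^ n * (n`! * n`!) * c.+1 ^ (n + n) * (n * d.+1 ^ n * d.+1 ^ n) * 4 ^ n
   = n`! * n`! * (n * (16 * c.+1 ^ 2 * d.+1 ^ 2) ^ n).
  rewrite !expnMn -[16]/(4 * 4) expnMn !expnD; lia.
rewrite ltn_pmul2l //.
apply: leq_ltn_trans (_ : (2 * (16 * c.+1 ^ 2 * d.+1 ^ 2)) ^ n < _).
  by rewrite [in X in _ <= X]expnMn leq_mul2r ltnW ?orbT // ltn_expl.
rewrite ltn_exp2r // !mulnA; lia.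
Qed.

Theorem theorem1p1 (R : realType) (X : graph_family)
    (X_class : is_graph_class X) (X_monotone : monotone_class X)
    (X_small : small_class R X) :
  exists d : nat, forall (T : finType) (G : sgraph T),
    X T G -> degeneracy G <= d.
Proof.
have [c cP] := small_class_nat X_small.
have [d hd] := exp_beats_quadratic (32 * c.+1 ^ 2).
exists (2 * d) => T G XG; rewrite /degeneracy; case: ex_minnP => m _; apply.
apply/forallP => V; apply/implyP => /set0Pn[v vV].
apply/forallP => H; apply/implyP => HG; apply/contraT => /existsPn degH.
have XH := X_monotone _ _ _ _ HG XG.
have [|x|n [n0 count]] := min_degree_count (d := d) X_class X_monotone XH.
- by apply/card_gt0P; exists (Sub v vV).
- by rewrite ltnNge degH.
by case: (count_contradiction n0 hd (cP _) count).
Qed.
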